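(* Let $G_1$, $G_2$ be generators over event sets $\Sigma_1$, $\Sigma_2$, let $G_k$ be a coordinator over $\Sigma_k$ with $\Sigma_1\cap\Sigma_2\subseteq\Sigma_k\subseteq\Sigma_1\cup\Sigma_2$, and let $K\subseteq C\subseteq L_m(G_1\parallel G_2\parallel G_k)$ be languages. With all notions taken with respect to $G_1,G_2,G_k$ and the observation projections $Q_{1+k},Q_{2+k},Q_k$, the following hold: 1. If $K$ is conditionally normal, then $K$ is conditionally strong $C$-observable. 2. If $K$ is conditionally strong $C$-observable, then $K$ is conditionally $C$-observable. 3. If $K$ is conditionally $C$-observable, then $K$ is conditionally observable.
   Context: Languages are sets of finite words. A generator $G=(Q,\Sigma,f,q_0,Q_m)$ is a finite deterministic automaton with partial transition function $f$; $L(G)=\{s\in\Sigma^*\mid f(q_0,s)\text{ is defined}\}$ is its (prefix-closed) generated language and $L_m(G)=\{s\in\Sigma^*\mid f(q_0,s)\in Q_m\}\subseteq L(G)$ its marked language. $\overline{L}$ denotes the prefix closure of $L$. For $\Sigma'\subseteq\Sigma$ the projection $\Sigma^*\to\Sigma'^*$ is the homomorphism erasing events outside $\Sigma'$ and fixing events of $\Sigma'$. For $L_1\subseteq\Sigma_1^*$, $L_2\subseteq\Sigma_2^*$, the synchronous product is $L_1\parallel L_2=P_1^{-1}(L_1)\cap P_2^{-1}(L_2)\subseteq(\Sigma_1\cup\Sigma_2)^*$, where $P_i:(\Sigma_1\cup\Sigma_2)^*\to\Sigma_i^*$ are projections; the synchronous product of generators satisfies $L(G_1\parallel G_2)=L(G_1)\parallel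 L(G_2)$ and $L_m(G_1\parallel G_2)=L_m(G_1)\parallel L_m(G_2)$. Let $\Sigma=\Sigma_1\cup\Sigma_2$, let $\Sigma_o\subseteq\Sigma$ be the set of observable events, and write $\Sigma_{i+k}=\Sigma_i\cup\Sigma_k$ and $\Sigma_{j,o}=\Sigma_j\cap\Sigma_o$. $P_k:\Sigma^*\to\Sigma_k^*$ and $P_{i+k}:\Sigma^*\to\Sigma_{i+k}^*$ ($i=1,2$) are projections, and $Q_j:\Sigma_j^*\to\Sigma_{j,o}^*$, for $j=1+k,2+k,k$, are the observation projections. Basic notions, for languages over an event set $\Delta$, a prefix-closed $L\subseteq\Delta^*$ and a projection $Q:\Delta^*\to\Delta_o^*$: - For $K\subseteq C$, $K$ is $C$-observable with respect to $L$ and $Q$ if for all $s,s'\in\Delta^*$ with $Q(s)=Q(s')$ and all $\sigma\in\Delta$: $s\sigma\in\overline K$, $s'\in\overline C$ and $s'\sigma\in L$ imply $s'\sigma\in\overline K$. - $K$ is observable with respect to $L$ and $Q$ if it is $K$-observable with respect to $L$ and $Q$. - $K\subseteq L$ is normal with respect to $L$ and $Q$ if $\overline K=Q^{-1}Q(\overline K)\cap L$. Conditional notions, for $K\subseteq C\subseteq L_m(G_1\parallel G_2\parallel G_k)$: - $K$ is conditionally normal if $P_k(K)$ is normal with respect to $L(G_k)$ and $Q_k$, and, for $i=1,2$, $P_{i+k}(K)$ is normal with respect to $L(G_i)\parallel\overline{P_k(K)}$ and $Q_{i+k}$. - $K$ is conditionally $C$-observable if $P_k(K)$ is $P_k(C)$-observable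 with respect to $L(G_k)$ and $Q_k$, and, for $i=1,2$, $P_{i+k}(K)$ is $P_{i+k}(C)$-observable with respect to $L(G_i)\parallel\overline{P_k(K)}$ and $Q_{i+k}$. - $K$ is conditionally strong $C$-observable if $P_k(K)$ is $P_k(C)$-observable with respect to $L(G_k)$ and $Q_k$, and, for $i=1,2$, $P_{i+k}(K)$ is $P_{i+k}(C)$-observable with respect to $L(G_i)\parallel L(G_k)$ and $Q_{i+k}$. - $K$ is conditionally observable if $P_k(K)$ is observable with respect to $L(G_k)$ and $Q_k$, and, for $i=1,2$, $P_{i+k}(K)$ is observable with respect to $L(G_i)\parallel\overline{P_k(K)}$ and $Q_{i+k}$. *)

(* Defs.v *)
From mathcomp Require Import all_boot.
From mathcomp Require Import boolp classical_sets.

Set Implicit Arguments.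
Unset Strict Implicit.
Unset Printing Implicit Defensive.

Local Open Scope classical_set_scope.

(* All event sets are subsets of an ambient finite type E of events.  Since a  *)
(* word [seq E] may use events outside a given event set, notions relative to  *)
(* Delta^* carry Delta explicitly.                                             *)
Definition language (E : finType) := set (seq E).

Section Languages.
Variable E : finType.
Implicit Types (A D Do : {set E}) (K L C : language E).

Definition words A : language E := [set s | {subset s <= A}].

Definition pclosure L : language E := [set s | exists2 t, L t & prefix s t].

Definition proj A (s : seq E) : seq E := [seq a <- s | a \in A].

(* Inverse image under the projection D^* -> A^*.                              *)
Definition proj_inv D A L : language E := words D `&` proj A @^-1` L.

Definition sync (A1 A2 : {set E}) (L1 L2 : language E) : language E :=
  proj_inv (A1 :|: A2) A1 L1 `&` proj_inv (A1 :|: A2) A2 L2.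

(* In the next three notions the observation projection is D^* -> Do^*.        *)
Definition C_observable D Do L C K : Prop :=
  forall (s s' : seq E) (a : E),
    words D s -> words D s' -> a \in D -> proj Do s = proj Do s' ->
    pclosure K (rcons s a) -> pclosure C s' -> L (rcons s' a) ->
    pclosure K (rcons s' a).

Definition observable D Do L K : Prop := C_observable D Do L K K.

(* The side condition K `<=` L is implied by the equality.                     *)
Definition normal D Do L K : Prop :=
  pclosure K = proj_inv D Do (proj Do @` pclosure K) `&` L.

End Languages.

Record generator (E : finType) (A : {set E}) := Generator {
  state : finType;
  trans : state -> E -> option state;
  init : state;
  marked : {set state};
  trans_out : forall q a, a \notin A -> trans q a = None }.

Section Generators.
Variables (E : finType) (A : {set E}) (G : generator A).

Fixpoint run (q : state G) (s : seq E) : option (state G) :=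
  if s is a :: s' then obind (run^~ s') (trans q a) else Some q.

Definition gen_lang : language E := [set s | isSome (run (init G) s)].

Definition mark_lang : language E :=
  [set s | exists2 q, run (init G) s = Some q & q \in marked G].

End Generators.

Section GeneratorSync.
Variables (E : finType) (A1 A2 : {set E}).
Variables (G1 : generator A1) (G2 : generator A2).

(* A component moves exactly on the events of its own event set.               *)
Definition local_step (A : {set E}) (G : generator A) (q : state G) (a : E) :
    option (state G) :=
  if a \in A then trans q a else Some q.

Definition gsync_trans (q : state G1 * state G2) (a : E) :
    option (state G1 * state G2) :=
  if a \notin A1 :|: A2 then None else
  match local_step q.1 a, local_step q.2 a with
  | Some q1, Some q2 => Some (q1, q2)
  | _, _ => None
  end.

Lemma gsync_trans_out q a : a \notin A1 :|: A2 -> gsync_trans q a = None.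
Proof. by rewrite /gsync_trans => ->. Qed.

Definition gsync : generator (A1 :|: A2) :=
  Generator (init G1, init G2) (finset.setX (marked G1) (marked G2)) gsync_trans_out.

Lemma run_gsync (q : state gsync) (s : seq E) (q' : state gsync) :
  run q s = Some q' <->
  [/\ words (A1 :|: A2) s, run q.1 (proj A1 s) = Some q'.1
    & run q.2 (proj A2 s) = Some q'.2].
Proof.
elim: s q => [|a s IHs] q /=.
  by case: q q' => [q1 q2] [q1' q2']; split=> [[-> ->]|[_ [->] [->]]].
have wE : words (A1 :|: A2) (a :: s) =
    (a \in A1 :|: A2 /\ words (A1 :|: A2) s).
  apply/propext; split=> [w|[ha w] x]; last by rewrite inE => /predU1P [->|/w].
  by split=> [|x xs]; apply: w; rewrite inE ?eqxx // xs orbT.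
rewrite wE /gsync_trans /local_step finset.in_setU.
case: (a \in A1); case: (a \in A2) => /=; last by split=> // -[[]].
- case: (trans q.1 a) => [q1|] /=; last by split=> // -[].
  case: (trans q.2 a) => [q2|] /=; last by split=> // -[].
  by rewrite (propext (IHs (q1, q2))); split=> [[]|[[]]].
- case: (trans q.1 a) => [q1|] /=; last by split=> // -[].
  by rewrite (propext (IHs (q1, q.2))); split=> [[]|[[]]].
- case: (trans q.2 a) => [q2|] /=; last by split=> // -[].
  by rewrite (propext (IHs (q.1, q2))); split=> [[]|[[]]].
Qed.

Lemma gen_lang_gsync :
  gen_lang gsync = sync A1 A2 (gen_lang G1) (gen_lang G2).
Proof.
apply/seteqP; split=> s.
  rewrite /gen_lang /=; case E0: (run _ _) => [q|//] _.
  by have /run_gsync [w r1 r2] := E0; split; split=> //=; rewrite ?r1 ?r2.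
case=> -[w] /=; rewrite /gen_lang /=; case E1: (run _ _) => [q1|//] _.
case=> _ /=; case E2: (run _ _) => [q2|//] _.
by have /run_gsync -> : [/\ words (A1 :|: A2) s,
  run (init gsync).1 (proj A1 s) = Some (q1, q2).1
  & run (init gsync).2 (proj A2 s) = Some (q1, q2).2] by [].
Qed.

Lemma mark_lang_gsync :
  mark_lang gsync = sync A1 A2 (mark_lang G1) (mark_lang G2).
Proof.
apply/seteqP; split=> s.
  case=> q /run_gsync [w r1 r2]; case: q r1 r2 => q1 q2 r1 r2.
  by rewrite finset.in_setX => /andP [m1 m2]; split; split=> //; [exists q1|exists q2].
case=> -[w [q1 r1 m1]] [_ [q2 r2 m2]].
by exists (q1, q2); [apply/run_gsync|rewrite finset.in_setX m1 m2].
Qed.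

End GeneratorSync.

Section Conditional.
Variables (E : finType) (S1 S2 Sk So : {set E}).
Variables (G1 : generator S1) (G2 : generator S2) (Gk : generator Sk).
Implicit Types K C : language E.

Definition cond_normal K : Prop :=
  [/\ normal Sk (Sk :&: So) (gen_lang Gk) (proj Sk @` K),
      normal (S1 :|: Sk) ((S1 :|: Sk) :&: So)
        (sync S1 Sk (gen_lang G1) (pclosure (proj Sk @` K)))
        (proj (S1 :|: Sk) @` K)
    & normal (S2 :|: Sk) ((S2 :|: Sk) :&: So)
        (sync S2 Sk (gen_lang G2) (pclosure (proj Sk @` K)))
        (proj (S2 :|: Sk) @` K)].

Definition cond_C_observable C K : Prop :=
  [/\ C_observable Sk (Sk :&: So) (gen_lang Gk) (proj Sk @` C) (proj Sk @` K),
      C_observable (S1 :|: Sk) ((S1 :|: Sk) :&: So)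
        (sync S1 Sk (gen_lang G1) (pclosure (proj Sk @` K)))
        (proj (S1 :|: Sk) @` C) (proj (S1 :|: Sk) @` K)
    & C_observable (S2 :|: Sk) ((S2 :|: Sk) :&: So)
        (sync S2 Sk (gen_lang G2) (pclosure (proj Sk @` K)))
        (proj (S2 :|: Sk) @` C) (proj (S2 :|: Sk) @` K)].

Definition cond_strong_C_observable C K : Prop :=
  [/\ C_observable Sk (Sk :&: So) (gen_lang Gk) (proj Sk @` C) (proj Sk @` K),
      C_observable (S1 :|: Sk) ((S1 :|: Sk) :&: So)
        (sync S1 Sk (gen_lang G1) (gen_lang Gk))
        (proj (S1 :|: Sk) @` C) (proj (S1 :|: Sk) @` K)
    & C_observable (S2 :|: Sk) ((S2 :|: Sk) :&: So)
        (sync S2 Sk (gen_lang G2) (gen_lang Gk))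
        (proj (S2 :|: Sk) @` C) (proj (S2 :|: Sk) @` K)].

Definition cond_observable K : Prop :=
  [/\ observable Sk (Sk :&: So) (gen_lang Gk) (proj Sk @` K),
      observable (S1 :|: Sk) ((S1 :|: Sk) :&: So)
        (sync S1 Sk (gen_lang G1) (pclosure (proj Sk @` K)))
        (proj (S1 :|: Sk) @` K)
    & observable (S2 :|: Sk) ((S2 :|: Sk) :&: So)
        (sync S2 Sk (gen_lang G2) (pclosure (proj Sk @` K)))
        (proj (S2 :|: Sk) @` K)].

End Conditional.

(* Main.v *)
Require Import Defs.
From mathcomp Require Import all_boot.
From mathcomp Require Import boolp classical_sets.

Local Open Scope classical_set_scope.

(* If s sigma lies in the closure of K and s, s' look alike, then s' sigma     *)
(* looks like s sigma, so normality alone yields observability.  The only      *)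
(* other point is that P_(i+k)(K), normal with respect to L(G_i) || cl P_k(K), *)
(* is normal with respect to the larger L(G_i) || L(G_k), because P_k(K) is    *)
(* itself normal in L(G_k): normality is transitive along the product.         *)

Section Languages.
Set Implicit Arguments.
Unset Strict Implicit.
Context {E : finType}.
Implicit Types (A B D Do : {set E}) (K L C : language E).

Lemma proj_rcons A (s : seq E) (a : E) :
  proj A (rcons s a) = proj A s ++ proj A [:: a].
Proof. by rewrite /proj filter_rcons /=; case: ifP; rewrite ?cats0 ?cats1. Qed.

Lemma proj_proj A B (s : seq E) : A \subset B -> proj A (proj B s) = proj A s.
Proof.
move=> /fintype.subsetP AB; rewrite /proj -filter_predI; apply: eq_filter => a /=.
by case: (boolP (a \in A)) => // /AB ->.
Qed.

Lemma proj_prefix A (s t : seq E) : prefix s t -> prefix (proj A s) (proj A t).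
Proof. by case/prefixP => u ->; rewrite /proj filter_cat prefix_prefix. Qed.

Lemma pclosureS K C : K `<=` C -> pclosure K `<=` pclosure C.
Proof. by move=> KC s [t /KC Ct st]; exists t. Qed.

Lemma proj_pclosure A K s :
  pclosure K s -> pclosure (proj A @` K) (proj A s).
Proof.
by case=> t Kt st; exists (proj A t); [exists t|exact: proj_prefix].
Qed.

Lemma pclosure_gen_lang A (G : generator A) K :
  K `<=` gen_lang G -> pclosure K `<=` gen_lang G.
Proof.
move=> KG s [t /KG + /prefixP [u tE]]; rewrite {}tE /gen_lang /=.
by elim: s (init G) => [|a s IHs] q //=; case: (trans q a) => //= q'; apply: IHs.
Qed.

Lemma mark_lang_gen A (G : generator A) : mark_lang G `<=` gen_lang G.
Proof. by move=> s [q + _]; rewrite /gen_lang /= => ->. Qed.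

Lemma syncSr A B L L1 L2 : L1 `<=` L2 -> sync A B L L1 `<=` sync A B L L2.
Proof. by move=> L12 s [sL [ws /L12 sL2]]. Qed.

Lemma C_observable_mono D Do L L' C C' K :
  L' `<=` L -> C' `<=` C ->
  C_observable D Do L C K -> C_observable D Do L' C' K.
Proof.
move=> LL CC obs s s' a ws ws' aD Qss Ksa Cs' Ls'a.
exact: obs ws ws' aD Qss Ksa (pclosureS CC Cs') (LL _ Ls'a).
Qed.

Lemma normal_C_observable D Do L C K :
  normal D Do L K -> C_observable D Do L C K.
Proof.
move=> nK s s' a _ ws' aD Qss Ksa _ Ls'a; rewrite nK; split=> //; split.
  by move=> x; rewrite mem_rcons inE => /predU1P [->|/ws'].
by exists (rcons s a) => //; rewrite !proj_rcons Qss.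
Qed.

Lemma normal_sync_trans A B So L LB K :
  normal B (B :&: So) LB (proj B @` K) ->
  normal (A :|: B) ((A :|: B) :&: So) (sync A B L (pclosure (proj B @` K)))
    (proj (A :|: B) @` K) ->
  normal (A :|: B) ((A :|: B) :&: So) (sync A B L LB) (proj (A :|: B) @` K).
Proof.
move=> nB nAB; apply/seteqP; split=> s.
  (* By [nB], the closure of P_B(K) lies in [LB]. *)
  rewrite {1}nAB => -[Qs Ls]; split=> //; apply: syncSr Ls => t.
  by rewrite nB => -[].
(* What remains is that [proj B s] lies in the closure of P_B(K); [nB] reduces this to finding a
   word there with the same observation. *)
case=> Qs [sL [ws sLB]]; rewrite nAB; split=> //; split=> //; split=> //=.
rewrite nB; split=> //; split.
  by move=> x; rewrite mem_filter => /andP [].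
(* [t] looks like [s] over [A :|: B], hence also after projection to [B]. *)
case: Qs => _ [t Kt Qts]; exists (proj B t).
  have := proj_pclosure B Kt; rewrite image_comp.
  congr (pclosure _ _); apply: eq_imagel => u _ /=.
  by rewrite proj_proj ?finset.subsetUr.
(* Observing [B] factors through observing [A :|: B], where [s] and [t] agree. *)
have sB : B :&: So \subset B := finset.subsetIl B So.
have sAB : B :&: So \subset (A :|: B) :&: So by rewrite finset.setSI ?finset.subsetUr.
by rewrite !(proj_proj _ sB) -(proj_proj t sAB) Qts proj_proj.
Qed.

End Languages.

Theorem theorem9 (E : finType) (S1 S2 Sk So : {set E})
    (G1 : generator S1) (G2 : generator S2) (Gk : generator Sk)
    (K C : language E)
    (hSk_lb : S1 :&: S2 \subset Sk) (hSk_ub : Sk \subset S1 :|: S2)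
    (hSo : So \subset S1 :|: S2)
    (hKC : K `<=` C) (hC : C `<=` mark_lang (gsync (gsync G1 G2) Gk)) :
  [/\ cond_normal So G1 G2 Gk K -> cond_strong_C_observable So G1 G2 Gk C K,
      cond_strong_C_observable So G1 G2 Gk C K -> cond_C_observable So G1 G2 Gk C K
    & cond_C_observable So G1 G2 Gk C K -> cond_observable So G1 G2 Gk K].
Proof.
(* P_k(K) lies in L_m(G_k) because K lies in the marked language of the whole product. *)
have KGk : pclosure (proj Sk @` K) `<=` gen_lang Gk.
  apply: pclosure_gen_lang => _ [s /hKC /hC + <-].
  by rewrite mark_lang_gsync => -[_ [_ /mark_lang_gen]].
split=> [[nk n1 n2]|[ok o1 o2]|[ok o1 o2]]; split=> //.
- exact: normal_C_observable nk.
- exact: normal_C_observable (normal_sync_trans nk n1).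
- exact: normal_C_observable (normal_sync_trans nk n2).
- exact: C_observable_mono (syncSr KGk) (@subset_refl _ _) o1.
- exact: C_observable_mono (syncSr KGk) (@subset_refl _ _) o2.
- exact: C_observable_mono (@subset_refl _ _) (image_subset hKC) ok.
- exact: C_observable_mono (@subset_refl _ _) (image_subset hKC) o1.
- exact: C_observable_mono (@subset_refl _ _) (image_subset hKC) o2.
Qed.
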